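(* Let $T=2$ and $L=\ell=1$, so that $P\subset\mathbb{R}^5$ has variables $(x,y,u)=(x_1,x_2,y_1,y_2,u_2)$. Consider the linear inequalities \begin{align*} &\text{(a)}\quad u_2\ge 0,\quad u_2\ge y_2-y_1,\\ &\text{(b)}\quad u_2\le y_2,\quad y_1+u_2\le 1,\\ &\text{(c)}\quad x_1\ge \underline{C}y_1,\quad x_2\ge\underline{C}y_2,\\ &\text{(d)}\quad x_1\le \overline{V}y_1+(\overline{C}-\overline{V})(y_2-u_2),\\ &\text{(e)}\quad x_2\le \overline{C}y_2-(\overline{C}-\overline{V})u_2,\\ &\text{(f)}\quad x_2-x_1\le(\underline{C}+V)y_2-\underline{C}y_1-(\underline{C}+V-\overline{V})u_2,\\ &\text{(g)}\quad x_1-x_2\le\overline{V}y_1-(\overline{V}-V)y_2-(\underline{C}+V-\overline{V})u_2. \end{align*} If $\overline{C}-\underline{C}-V\ge 0$, then $\mathrm{conv}(P)=\{(x,y,u)\in\mathbb{R}^5:\text{(a)--(g) hold}\}$. If $\overline{C}-\underline{C}-V<0$, then $\mathrm{conv}(P)=\{(x,y,u)\in\mathbb{R}^5:\text{(a)--(e) hold}\}$.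
   Context: $T$ is the number of time periods, $L,\ell$ are positive integers (minimum-up and minimum-down time), and $\underline{C},\overline{C},\overline{V},V$ are real parameters (generation lower bound, generation upper bound, start-up/shut-down ramp rate, ramp rate in the stable region) with $0\le\underline{C}\le\overline{V}\le\overline{C}$ and $V>0$. For integers $a,b$, $[a,b]_{\mathbb{Z}}$ is the set of integers $i$ with $a\le i\le b$. $P$ is the set of $(x,y,u)\in\mathbb{R}_+^T\times\{0,1\}^T\times\{0,1\}^{T-1}$, with $x=(x_1,\dots,x_T)$, $y=(y_1,\dots,y_T)$, $u=(u_2,\dots,u_T)$, such that \begin{align*} &\textstyle\sum_{i=t-L+1}^{t}u_i\le y_t,\ t\in[L+1,T]_{\mathbb{Z}};\qquad \sum_{i=t-\ell+1}^{t}u_i\le 1-y_{t-\ell},\ t\in[\ell+1,T]_{\mathbb{Z}};\\ &y_t-y_{t-1}-u_t\le 0,\ t\in[2,T]_{\mathbb{Z}};\qquad \underline{C}y_t\le x_t\le\overline{C}y_t,\ t\in[1,T]_{\mathbb{Z}};\\ &x_t-x_{t-1}\le Vy_{t-1}+\overline{V}(1-y_{t-1}),\ t\in[2,T]_{\mathbb{Z}};\qquad x_{t-1}-x_t\le Vy_t+\overline{V}(1-y_t),\ t\in[2,T]_{\mathbb{Z}}. \end{align*} $\mathrm{conv}(P)$ denotes the convex hull of $P$. *)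

(* Defs.v *)
From HB Require Import structures.
From mathcomp Require Import all_boot all_order all_algebra.
From mathcomp Require Import boolp classical_sets reals convex.

Set Implicit Arguments.
Unset Strict Implicit.
Unset Printing Implicit Defensive.

Import Order.TTheory GRing.Theory Num.Theory.

Local Open Scope classical_set_scope.
Local Open Scope ring_scope.

Definition convex_hull (R : numDomainType) (M : lmodType R) (A : set M) :
  set M := smallest (@convex_set R M) A.

(* Points (x, y, u) = ((x_1, .., x_T), (y_1, .., y_T), (u_2, .., u_T)). *)
Definition uc_point (R : realType) (T : nat) : lmodType R :=
  ('rV[R]_T * 'rV[R]_T * 'rV[R]_(T.-1))%type.

(* The entry of [v] at the 0-based position [k], and 0 out of range. *)
Definition entry (R : realType) (n : nat) (v : 'rV[R]_n) (k : nat) : R :=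
  if insub k is Some i then v 0 i else 0.

(* Time indices are 1-based: x and y are indexed by 1, .., T and u by
   2, .., T. *)
Definition gen (R : realType) (T : nat) (z : uc_point R T) (t : nat) : R :=
  entry z.1.1 (t - 1).
Definition onoff (R : realType) (T : nat) (z : uc_point R T) (t : nat) : R :=
  entry z.1.2 (t - 1).
Definition startup (R : realType) (T : nat) (z : uc_point R T) (t : nat) : R :=
  entry z.2 (t - 2).

(* [Cl], [Cu] are the lower and upper generation bounds, [Vs] is the
   start-up/shut-down ramp rate (V with an overline) and [V] the ramp rate in
   the stable region. In every constraint below the subtractions on time
   indices are exact and the entries are in range when [L] and [l] are
   positive. *)
Record feasible (R : realType) (T L l : nat) (Cl Cu Vs V : R)
    (z : uc_point R T) : Prop := Feasible {
  feas_x_ge0 : forall t, (1 <= t <= T)%N -> 0 <= gen z t;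
  feas_y_bin : forall t, (1 <= t <= T)%N -> onoff z t = 0 \/ onoff z t = 1;
  feas_u_bin : forall t, (2 <= t <= T)%N -> startup z t = 0 \/ startup z t = 1;
  feas_minup : forall t, (L + 1 <= t <= T)%N ->
    \sum_(t - L + 1 <= i < t.+1) startup z i <= onoff z t;
  feas_mindown : forall t, (l + 1 <= t <= T)%N ->
    \sum_(t - l + 1 <= i < t.+1) startup z i <= 1 - onoff z (t - l);
  feas_start : forall t, (2 <= t <= T)%N ->
    onoff z t - onoff z (t - 1) - startup z t <= 0;
  feas_bounds : forall t, (1 <= t <= T)%N ->
    Cl * onoff z t <= gen z t <= Cu * onoff z t;
  feas_rampup : forall t, (2 <= t <= T)%N ->
    gen z t - gen z (t - 1) <=
      V * onoff z (t - 1) + Vs * (1 - onoff z (t - 1));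
  feas_rampdown : forall t, (2 <= t <= T)%N ->
    gen z (t - 1) - gen z t <= V * onoff z t + Vs * (1 - onoff z t)
}.

Definition feasible_set (R : realType) (T L l : nat) (Cl Cu Vs V : R) :
  set (uc_point R T) := [set z | feasible L l Cl Cu Vs V z].

Definition ineqs_ae (R : realType) (Cl Cu Vs : R) : set (uc_point R 2) :=
  [set z | let x1 := gen z 1 in let x2 := gen z 2 in
           let y1 := onoff z 1 in let y2 := onoff z 2 in
           let u2 := startup z 2 in
    [/\ 0 <= u2 /\ y2 - y1 <= u2,
        u2 <= y2 /\ y1 + u2 <= 1,
        Cl * y1 <= x1 /\ Cl * y2 <= x2,
        x1 <= Vs * y1 + (Cu - Vs) * (y2 - u2)
      & x2 <= Cu * y2 - (Cu - Vs) * u2]].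

Definition ineqs_fg (R : realType) (Cl Vs V : R) : set (uc_point R 2) :=
  [set z | let x1 := gen z 1 in let x2 := gen z 2 in
           let y1 := onoff z 1 in let y2 := onoff z 2 in
           let u2 := startup z 2 in
    x2 - x1 <= (Cl + V) * y2 - Cl * y1 - (Cl + V - Vs) * u2 /\
    x1 - x2 <= Vs * y1 - (Vs - V) * y2 - (Cl + V - Vs) * u2].
Arguments feasible_set {R} T L l Cl Cu Vs V _.

(* Main.v *)
(* A feasible point has one of the four on/off patterns (y1, y2, u2) = (1,1,0),
   (1,0,0), (0,1,1), (0,0,0), which are affinely independent. Hence a point
   of the hull determines the weights y2 - u2, y1 - y2 + u2, u2 and 1 - y1 - u2 of
   the patterns, nonnegative by (a) and (b), and only the generation levels
   remain to be split. Pattern (1,1,0) must take a share of x1 and a share of x2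
   from two intervals, nonempty by (c)-(e), with a difference of at most
   (y2 - u2) V. Such shares exist because the lower end of each interval exceeds
   the upper end of the other by at most (y2 - u2) V, and this is what (f) and
   (g) say; they follow from (c)-(e) when Cu < Cl + V. *)
Require Import Defs.
From HB Require Import structures.
From mathcomp Require Import all_boot all_order all_algebra.
From mathcomp Require Import boolp classical_sets reals convex.
From mathcomp Require Import interval_inference ring lra.

Import Order.TTheory GRing.Theory Num.Theory.

Local Open Scope classical_set_scope.
Local Open Scope ring_scope.

(** * Convex sets and convex hulls *)

(** Dividing by [a + b] gives a convex combination; if the sum is 0, both weights vanish and any
    point serves. Several weighted points can thus be merged pairwise even when partial sums are
    zero. *)
Lemma convex_set_conic (R : numFieldType) (M : lmodType R) (A : set M)
    (a b : R) (x y : M) :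
  @convex_set R M A -> A x -> A y -> 0 <= a -> 0 <= b ->
  exists2 z, A z & a *: x + b *: y = (a + b) *: z.
Proof.
move=> cA Ax Ay a0 b0.
have [ab0|ab0] := eqVneq (a + b) 0.
  exists x => //; move/eqP: (ab0); rewrite paddr_eq0// => /andP[/eqP-> /eqP->].
  by rewrite addr0 !scale0r addr0.
have ab_gt0 : 0 < a + b by rewrite lt_neqAle eq_sym ab0 addr_ge0.
have t0 : 0 <= a / (a + b) by rewrite divr_ge0// ltW.
have t1 : a / (a + b) <= 1 by rewrite ler_pdivrMr// mul1r lerDl.
exists (a / (a + b) *: x + (1 - a / (a + b)) *: y).
  exact/set_mem/(cA x y (Itv01 t0 t1) (mem_set Ax) (mem_set Ay)).
by rewrite scalerDr !scalerA; congr (_ *: _ + _ *: _); field.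
Qed.

Arguments convex_set_conic {R M A a b x y}.

Lemma convex_setP (R : numDomainType) (M : lmodType R) (A : set M) :
  (forall (x y : M) (t : R), A x -> A y -> 0 <= t -> t <= 1 ->
     A (t *: x + (1 - t) *: y)) ->
  @convex_set R M A.
Proof.
move=> cA x y t /set_mem Ax /set_mem Ay; apply/mem_set.
by apply: cA.
Qed.

Lemma sub_convex_hull (R : numDomainType) (M : lmodType R) (A : set M) :
  A `<=` convex_hull A.
Proof. exact: sub_gen_smallest. Qed.

Lemma convex_convex_hull (R : numDomainType) (M : lmodType R) (A : set M) :
  @convex_set R M (convex_hull A).
Proof.
move=> x y t /set_mem Ax /set_mem Ay; apply/mem_set => B [cB AB].
by apply/set_mem/cB; apply/mem_set; [apply: Ax|apply: Ay].
Qed.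

(** * Linearity of coordinates, and points with two periods *)

Lemma entryD (R : realType) (n : nat) (v w : 'rV[R]_n) (k : nat) :
  entry (v + w) k = entry v k + entry w k.
Proof. by rewrite /entry; case: insubP => [i _ _|_]; rewrite ?mxE ?addr0. Qed.

Lemma entryZ (R : realType) (n : nat) (a : R) (v : 'rV[R]_n) (k : nat) :
  entry (a *: v) k = a * entry v k.
Proof. by rewrite /entry; case: insubP => [i _ _|_]; rewrite ?mxE ?mulr0. Qed.

Lemma entry_ord (R : realType) (n : nat) (v : 'rV[R]_n) (i : 'I_n) :
  entry v i = v 0 i.
Proof. by rewrite /entry valK. Qed.

Lemma entry_inj (R : realType) (n : nat) (v w : 'rV[R]_n) :
  (forall k, (k < n)%N -> entry v k = entry w k) -> v = w.
Proof. by move=> vw; apply/rowP => i; rewrite -!entry_ord vw. Qed.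

Lemma entry_row (R : realType) (n : nat) (f : nat -> R) (k : nat) :
  (k < n)%N -> entry (\row_(i < n) f i) k = f k.
Proof.
by move=> kn; rewrite -[k in LHS]/(nat_of_ord (Ordinal kn)) entry_ord mxE.
Qed.

Section UcPointLinear.
Variables (R : realType) (T : nat).
Implicit Types (z w : uc_point R T) (a : R) (t : nat).

Lemma genD z w t : gen (z + w) t = gen z t + gen w t.
Proof. exact: entryD. Qed.
Lemma genZ a z t : gen (a *: z) t = a * gen z t.
Proof. exact: entryZ. Qed.
Lemma onoffD z w t : onoff (z + w) t = onoff z t + onoff w t.
Proof. exact: entryD. Qed.
Lemma onoffZ a z t : onoff (a *: z) t = a * onoff z t.
Proof. exact: entryZ. Qed.
Lemma startupD z w t : startup (z + w) t = startup z t + startup w t.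
Proof. exact: entryD. Qed.
Lemma startupZ a z t : startup (a *: z) t = a * startup z t.
Proof. exact: entryZ. Qed.

Definition ucE :=
  (genD, genZ, onoffD, onoffZ, startupD, startupZ).

End UcPointLinear.

Definition uc2 (R : realType) (x1 x2 y1 y2 u2 : R) : uc_point R 2 :=
  (\row_(i < 2) nth 0 [:: x1; x2] i, \row_(i < 2) nth 0 [:: y1; y2] i,
   \row_(i < 1) nth 0 [:: u2] i).
Arguments uc2 {R}.

Section UcPoint2.
Variables (R : realType) (x1 x2 y1 y2 u2 : R).
Let z := uc2 x1 x2 y1 y2 u2.

Lemma gen1_uc2 : gen z 1 = x1. Proof. exact: entry_row. Qed.
Lemma gen2_uc2 : gen z 2 = x2. Proof. exact: entry_row. Qed.
Lemma onoff1_uc2 : onoff z 1 = y1. Proof. exact: entry_row. Qed.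
Lemma onoff2_uc2 : onoff z 2 = y2. Proof. exact: entry_row. Qed.
Lemma startup_uc2 : startup z 2 = u2. Proof. exact: entry_row. Qed.

End UcPoint2.

Definition uc2E := (gen1_uc2, gen2_uc2, onoff1_uc2, onoff2_uc2, startup_uc2).

Lemma uc_point2_eq (R : realType) (z w : uc_point R 2) :
  gen z 1 = gen w 1 -> gen z 2 = gen w 2 -> onoff z 1 = onoff w 1 ->
  onoff z 2 = onoff w 2 -> startup z 2 = startup w 2 -> z = w.
Proof.
case: z w => [[x y] u] [[x' y'] u'] ex1 ex2 ey1 ey2 eu.
by congr (_, _, _); apply: entry_inj => -[|[|]].
Qed.

(** With unit up and down times, each window sum has the single term [u2], at [t = 2]. *)
Lemma feasible2P (R : realType) (Cl Cu Vs V : R) (z : uc_point R 2) :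
  let x1 := gen z 1 in let x2 := gen z 2 in
  let y1 := onoff z 1 in let y2 := onoff z 2 in let u2 := startup z 2 in
  feasible 1 1 Cl Cu Vs V z <->
  [/\ 0 <= x1 /\ 0 <= x2,
      [/\ y1 = 0 \/ y1 = 1, y2 = 0 \/ y2 = 1 & u2 = 0 \/ u2 = 1],
      [/\ u2 <= y2, u2 <= 1 - y1 & y2 - y1 - u2 <= 0],
      Cl * y1 <= x1 <= Cu * y1 /\ Cl * y2 <= x2 <= Cu * y2
    & x2 - x1 <= V * y1 + Vs * (1 - y1) /\ x1 - x2 <= V * y2 + Vs * (1 - y2)].
Proof.
move=> x1 x2 y1 y2 u2; have sumu2 : \sum_(2 <= i < 3) startup z i = u2.
  by rewrite big_nat1.
split=> [[fx fy fu fup fdown fst fb fru frd]|].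
  by split; [split|split|split|split|split];
    rewrite ?(fx 1) ?(fx 2) ?(fb 1) ?(fb 2) ?(fst 2) ?(fru 2) ?(frd 2)//;
    [exact: fy|exact: fy|exact: fu|rewrite -sumu2; exact: (fup 2)
    |rewrite -sumu2; exact: (fdown 2)].
move=> [[fx1 fx2] [fy1 fy2 fu] [fup fdown fst] [fb1 fb2] [fru frd]].
by split=> -[|[|[|t]]]// _; rewrite ?big_nat1.
Qed.

(** The inequalities are linear, so they cut out a convex set, and it suffices to check them at
    feasible points. The sign of [Cu - Cl - V] does not matter here. *)
Lemma hull_sub_ineqs (R : realType) (Cl Cu Vs V : R) :
  0 <= Cl -> Cl <= Vs -> Vs <= Cu -> 0 < V ->
  convex_hull (feasible_set 2 1 1 Cl Cu Vs V) `<=`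
  ineqs_ae Cl Cu Vs `&` ineqs_fg Cl Vs V.
Proof.
move=> Cl0 ClVs VsCu V0; apply: smallest_sub.
  apply: convex_setP => z w t.
  move=> [[[a1 a2] [b1 b2] [c1 c2] d e] [f g]].
  move=> [[[a1' a2'] [b1' b2'] [c1' c2'] d' e'] [f' g']] t0 t1.
  have {}t1 : 0 <= 1 - t by rewrite subr_ge0.
  have comb p q p' q' : p <= q -> p' <= q' ->
      t * p + (1 - t) * p' <= t * q + (1 - t) * q'.
    by move=> pq pq'; rewrite lerD// ler_wpM2l.
  by split; split; [split|split|split| | | |]; rewrite !ucE;
    [have := comb _ _ _ _ a1 a1'|have := comb _ _ _ _ a2 a2'
    |have := comb _ _ _ _ b1 b1'|have := comb _ _ _ _ b2 b2'
    |have := comb _ _ _ _ c1 c1'|have := comb _ _ _ _ c2 c2'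
    |have := comb _ _ _ _ d d'|have := comb _ _ _ _ e e'
    |have := comb _ _ _ _ f f'|have := comb _ _ _ _ g g'];
    lra.
move=> z /feasible2P [[x10 x20] [y1b y2b ub] [h1 h2 h3]].
move=> [/andP[lx1 ux1] /andP[lx2 ux2]] [ru rd].
(* Of the eight binary patterns, [h1], [h2] and [h3] exclude four; in the others every inequality is
   linear in the generation levels. *)
split; split; [split|split|split| | | |];
  move: y1b y2b ub h1 h2 h3 lx1 ux1 lx2 ux2 ru rd; by do 3!move=> [->|->]; lra.
Qed.

(** * Decomposition of a point satisfying the inequalities *)

Lemma scale_itv (R : realFieldType) (w l h a : R) :
  0 <= w -> l <= h -> w * l <= a -> a <= w * h ->
  exists2 b, l <= b <= h & a = w * b.
Proof.
move=> w0 lh la ah; have [w_eq0|w_neq0] := eqVneq w 0.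
  by exists l; [rewrite lexx|rewrite w_eq0 in la ah *; lra].
have w_gt0 : 0 < w by rewrite lt_neqAle eq_sym w_neq0.
exists (a / w); last by field.
by rewrite ler_pdivlMr// ler_pdivrMr// ![_ * w]mulrC la ah.
Qed.

(** Start from the two lower ends. If they are more than [d] apart, raise the smaller one to
    distance [d]; the crossed bounds keep it inside its interval. *)
Lemma close_points_itv (R : realDomainType) (l1 h1 l2 h2 d : R) :
  0 <= d -> l1 <= h1 -> l2 <= h2 -> l1 <= h2 + d -> l2 <= h1 + d ->
  exists a1 a2, [/\ l1 <= a1 <= h1, l2 <= a2 <= h2, a1 - a2 <= d & a2 - a1 <= d].
Proof.
move=> d0 lh1 lh2 lh12 lh21.
exists (Num.max l1 (l2 - d)), (Num.max l2 (l1 - d)).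
by case: (leP l1 (l2 - d)); case: (leP l2 (l1 - d)) => ? ?; split; lra.
Qed.

Lemma ineqs_sub_hull (R : realType) (Cl Cu Vs V : R) :
  0 <= Cl -> Cl <= Vs -> Vs <= Cu -> 0 < V ->
  ineqs_ae Cl Cu Vs `&` ineqs_fg Cl Vs V `<=`
  convex_hull (feasible_set 2 1 1 Cl Cu Vs V).
Proof.
move=> Cl0 ClVs VsCu V0 z.
rewrite /ineqs_ae /ineqs_fg /=.
set x1 := gen z 1; set x2 := gen z 2; set y1 := onoff z 1; set y2 := onoff z 2.
set u := startup z 2.
move=> [[[u0 yu] [uy yu1] [c1 c2] d e] [f g]].
(* Weights of (1,1,0), (1,0,0) and (0,0,0); [u] itself is the weight of (0,1,1). Thus [y1 = w + p]
   and [y2 = w + u], and (c)-(g) are rewritten in these terms. *)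
pose w := y2 - u; pose p := y1 - w; pose q := 1 - y1 - u.
have w0 : 0 <= w by rewrite subr_ge0.
have p0 : 0 <= p by rewrite /p /w; lra.
have q0 : 0 <= q by rewrite /q; lra.
have {}c1 : w * Cl + p * Cl <= x1 by rewrite /p /w; lra.
have {}c2 : w * Cl + u * Cl <= x2 by rewrite /w; lra.
have {}d : x1 <= w * Cu + p * Vs by rewrite /p /w; lra.
have {}e : x2 <= w * Cu + u * Vs by rewrite /w; lra.
have {}f : x2 - x1 <= w * V + u * Vs - p * Cl by rewrite /p /w; lra.
have {}g : x1 - x2 <= w * V + p * Vs - u * Cl by rewrite /p /w; lra.
have wV0 : 0 <= w * V by rewrite mulr_ge0// ltW.
have wClCu : w * Cl <= w * Cu by rewrite ler_wpM2l//; lra.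
have pClVs : p * Cl <= p * Vs by rewrite ler_wpM2l.
have uClVs : u * Cl <= u * Vs by rewrite ler_wpM2l.
(* The share [A1] of [x1] lies between [w * Cl] and [w * Cu] and leaves a remainder between [p * Cl]
   and [p * Vs]; likewise for [A2], with [u] for [p]. *)
have := @close_points_itv _
  (Num.max (w * Cl) (x1 - p * Vs)) (Num.min (w * Cu) (x1 - p * Cl))
  (Num.max (w * Cl) (x2 - u * Vs)) (Num.min (w * Cu) (x2 - u * Cl)) (w * V) wV0.
rewrite !addr_minl !ge_max !le_min.
case; [lra|lra|lra|lra|move=> A1 [A2 []]].
rewrite !ge_max !le_min => A1lh A2lh A12 A21.
have ClCu : Cl <= Cu by exact: le_trans VsCu.
have [a1 [a2 [a1lh a2lh a12 [A1E A2E]]]] : exists a1 a2,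
    [/\ Cl <= a1 <= Cu, Cl <= a2 <= Cu, a1 - a2 <= V /\ a2 - a1 <= V
      & A1 = w * a1 /\ A2 = w * a2].
  have [w_eq0|w_neq0] := eqVneq w 0.
    (* Both shares are 0, so any admissible pair of levels will do. *)
    by rewrite w_eq0 in A1lh A2lh *; exists Cl, Cl; split; lra.
  have w_gt0 : 0 < w by rewrite lt_neqAle eq_sym w_neq0.
  have [a1 a1lh A1E] : exists2 a, Cl <= a <= Cu & A1 = w * a.
    by apply: scale_itv => //; lra.
  have [a2 a2lh A2E] : exists2 a, Cl <= a <= Cu & A2 = w * a.
    by apply: scale_itv => //; lra.
  exists a1, a2; split=> //.
  by split; rewrite -(ler_pM2l w_gt0) mulrBr -A1E -A2E.
(* The remainders go to the patterns with one period on, where ramping to or from 0 caps the level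
   at [Vs]. *)
have [b1 b1lh B1E] : exists2 b, Cl <= b <= Vs & x1 - A1 = p * b.
  by apply: scale_itv => //; lra.
have [b2 b2lh B2E] : exists2 b, Cl <= b <= Vs & x2 - A2 = u * b.
  by apply: scale_itv => //; lra.
have h11 : convex_hull (feasible_set 2 1 1 Cl Cu Vs V) (uc2 a1 a2 1 1 0).
  apply: sub_convex_hull; apply/feasible2P; rewrite /= !uc2E.
  by split; split; lra.
have h10 : convex_hull (feasible_set 2 1 1 Cl Cu Vs V) (uc2 b1 0 1 0 0).
  apply: sub_convex_hull; apply/feasible2P; rewrite /= !uc2E.
  by split; split; lra.
have h01 : convex_hull (feasible_set 2 1 1 Cl Cu Vs V) (uc2 0 b2 0 1 1).
  apply: sub_convex_hull; apply/feasible2P; rewrite /= !uc2E.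
  by split; split; lra.
have h00 : convex_hull (feasible_set 2 1 1 Cl Cu Vs V) (uc2 0 0 0 0 0).
  apply: sub_convex_hull; apply/feasible2P; rewrite /= !uc2E.
  by split; split; lra.
have cvx := @convex_convex_hull _ _ (feasible_set 2 1 1 Cl Cu Vs V).
(* The four points are merged in pairs; the total weight [w + p + (u + q)] is 1. *)
have [s hs sE] := convex_set_conic cvx h11 h10 w0 p0.
have [r hr rE] := convex_set_conic cvx h01 h00 u0 q0.
have wp0 := addr_ge0 w0 p0; have uq0 := addr_ge0 u0 q0.
have [v hv vE] := convex_set_conic cvx hs hr wp0 uq0.
suff -> : z = v by [].
have -> : v = w *: uc2 a1 a2 1 1 0 + p *: uc2 b1 0 1 0 0 +
    (u *: uc2 0 b2 0 1 1 + q *: uc2 0 0 0 0 0).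
  rewrite sE rE vE (_ : _ + _ = 1) ?scale1r//.
  by rewrite /p /q; ring.
apply: uc_point2_eq; rewrite !ucE !uc2E -/x1 -/x2 -/y1 -/y2 -/u.
- by rewrite -[x1](subrK A1) B1E A1E; ring.
- by rewrite -[x2](subrK A2) B2E A2E; ring.
- by rewrite /p; ring.
- by rewrite /w; ring.
- by ring.
Qed.

Theorem theorem1 (R : realType) (Cl Cu Vs V : R)
    (Cl_ge0 : 0 <= Cl) (Cl_le_Vs : Cl <= Vs) (Vs_le_Cu : Vs <= Cu)
    (V_gt0 : 0 < V) :
  (0 <= Cu - Cl - V ->
     convex_hull (feasible_set 2 1 1 Cl Cu Vs V) =
     ineqs_ae Cl Cu Vs `&` ineqs_fg Cl Vs V) /\
  (Cu - Cl - V < 0 ->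
     convex_hull (feasible_set 2 1 1 Cl Cu Vs V) = ineqs_ae Cl Cu Vs).
Proof.
have hullE : convex_hull (feasible_set 2 1 1 Cl Cu Vs V) =
    ineqs_ae Cl Cu Vs `&` ineqs_fg Cl Vs V.
  by apply/seteqP; split; [exact: hull_sub_ineqs|exact: ineqs_sub_hull].
split=> [//|CuV]; rewrite hullE; apply: setIidl => z.
rewrite /ineqs_ae /ineqs_fg /=.
move=> [[u0 yu] [uy yu1] [c1 c2] d e].
(* This product is exactly the excess over the bound of (f) when (e) is combined with [c1], and over
   that of (g) when (d) is combined with [c2]. *)
have : (onoff z 2 - startup z 2) * (Cu - Cl - V) <= 0.
  by rewrite mulr_ge0_le0 ?subr_ge0// ltW.
by split; lra.
Qed.
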